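(* Let $f:\mathbb{R}\to\mathbb{R}$. (a) If $f$ is $(\rho'\to\rho_<')$-computable, then $f$ is lower semi-continuous. (b) If $f$ is $(\rho_<'\to\rho_<')$-computable, then $f$ is monotonically increasing. (c) If $f$ is $(\rho''\to\rho'')$-computable, then $f$ is continuous. Each of (a), (b), (c) remains valid when computability is taken relative to an arbitrary oracle $\mathcal{O}\subseteq\Sigma^*$.
   Context: Fix a computable tupling function $\langle\cdots\rangle:\mathbb{N}^k\to\mathbb{N}$. Real numbers are encoded by infinite strings over a finite alphabet $\Sigma$ that code a sequence of rationals $(q_n)_{n\in\mathbb{N}}$ (each rational coded in a standard way); such a string is called a name. A $\rho'$-name of $x$ is a sequence $(q_n)$ with $x=\lim_n q_n$. A $\rho_<'$-name of $x$ is a sequence $(q_n)$ with $x=\sup_i\inf_j q_{\langle i,j\rangle}$. A $\rho''$-name of $x$ is a sequence $(q_n)$ with $x=\lim_i\lim_j q_{\langle i,j\rangle}$. A Type-2 machine is a Turing machine with a one-way read-only input tape holding an infinite string, work tapes, and a one-way write-only output tape; it computes the partial map sending an input to the infinite output it writes (defined when infinitely many symbols are written). For representations $\alpha,\beta$ of $\mathbb{R}$, $f$ is $(\alpha\to\beta)$-computable if some Type-2 machine transforms every $\alpha$-name of any $x\in\mathbb{R}$ into a $\beta$-name of $f(x)$; computability relative to $\mathcal{O}$ means the machine may additionally query membership in $\mathcal{O}$. *)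

(* Defs.v *)
From HB Require Import structures.
From mathcomp Require Import all_boot all_order all_algebra.
From mathcomp Require Import all_classical all_reals all_analysis.

Set Implicit Arguments.
Unset Strict Implicit.
Unset Printing Implicit Defensive.

Import Order.TTheory GRing.Theory Num.Theory.
Import numFieldNormedType.Exports.

Local Open Scope classical_set_scope.
Local Open Scope ring_scope.

Inductive symbol := D0 | D1 | Minus | Slash | Hash.

Definition stream := nat -> symbol.

(** ** Type-2 machines *)

Inductive move := MoveLeft | Stay | MoveRight.

(* A two-way infinite tape seen from its head; both sides are listed starting
   next to the head, and cells beyond either list are blank. *)
Record tape (G : Type) := Tape { tleft : seq G; thead : G; tright : seq G }.

Definition tape_act G (blank : G) (a : G * move) (t : tape G) : tape G :=
  let: Tape l _ r := t in
  let: (g, m) := a in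
  match m with
  | MoveLeft => Tape (behead l) (head blank l) (g :: r)
  | Stay => Tape l g r
  | MoveRight => Tape (g :: l) (head blank r) (behead r)
  end.

Record action (Q G : Type) (k : nat) := Action {
  next : Q;
  advance : bool;                (* move the input head one cell to the right *)
  work_act : 'I_k -> G * move;
  ask : option symbol;           (* symbol appended to the oracle query *)
  emit : option symbol }.        (* symbol appended to the output *)

(* A state [q] with [query q = Some (yes, no)] submits the word written on the
   oracle tape and passes to [yes] or [no] according to the answer.  Halting is
   not modelled separately: a halted machine has finite output, as has a machine
   looping without writing. *)
Record machine := Machine {
  state : finType;
  start : state;
  ntapes : nat;
  walpha : finType;
  blank : walpha;
  query : state -> option (state * state);
  delta : state -> symbol -> {ffun 'I_ntapes -> walpha} ->
          action state walpha ntapes }.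

Record config (M : machine) := Config {
  cstate : state M;
  cpos : nat;                               (* position of the input head *)
  cwork : 'I_(ntapes M) -> tape (walpha M);
  cquery : seq symbol;
  cout : seq symbol }.

Definition init (M : machine) : config M :=
  Config (start M) 0 (fun=> Tape [::] (blank M) [::]) [::] [::].

Definition append (w : seq symbol) (a : option symbol) : seq symbol :=
  if a is Some b then rcons w b else w.

(* One step with oracle [O] on input [s]; submitting a query erases it. *)
Definition step (O : set (seq symbol)) (M : machine) (s : stream)
    (c : config M) : config M :=
  match query (cstate c) with
  | Some (yes, no) =>
      Config (if cquery c \in O then yes else no)
             (cpos c) (cwork c) [::] (cout c)
  | None =>
      let a := delta (cstate c) (s (cpos c)) [ffun i => thead (cwork c i)] in
      Config (next a) (cpos c + advance a)%N
             (fun i => tape_act (blank M) (work_act a i) (cwork c i))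
             (append (cquery c) (ask a)) (append (cout c) (emit a))
  end.

Definition output_at (O : set (seq symbol)) (M : machine) (s : stream)
    (n : nat) : seq symbol := cout (iter n (step O s) (init M)).

(* With oracle [O], [M] maps the input [s] to the infinite output [t]. *)
Definition computes (O : set (seq symbol)) (M : machine) (s t : stream) : Prop :=
  (forall n, output_at O M s n = mkseq t (size (output_at O M s n))) /\
  (forall m, exists n, (m <= size (output_at O M s n))%N).

Definition oracle_free (M : machine) : Prop :=
  forall q : state M, query q = None.

(** ** Computable pairing functions *)

(* The pair [(i, j)] is given as 1^i 0 1^j 000..., the result [n] as 1^n 000... *)
Definition computable_pairing (p : nat -> nat -> nat) : Prop :=
  (forall i j i' j', p i j = p i' j' -> i = i' /\ j = j') /\
  exists M : machine, oracle_free M /\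
    forall i j, computes set0 M
      (nth D0 (nseq i D1 ++ D0 :: nseq j D1)) (nth D0 (nseq (p i j) D1)).

(** ** Names of real numbers *)

(* Value of a binary word, most significant digit first. *)
Definition binval (u : seq bool) : nat :=
  foldl (fun n (b : bool) => (2 * n + b)%N) 0%N u.

Definition digits (u : seq bool) : seq symbol :=
  [seq if b then D1 else D0 | b : bool <- u].

(* [w] is a signed fraction of binary numerals, not necessarily in lowest terms,
   denoting [q]. *)
Definition codes_rat (w : seq symbol) (q : rat) : Prop :=
  exists (neg : bool) (u v : seq bool),
    [/\ u <> [::], binval v <> 0%N,
        w = (if neg then [:: Minus] else [::]) ++ digits u ++ Slash :: digits v
      & q = (-1) ^+ neg * ((binval u)%:R / (binval v)%:R)].

(* [s] is the infinite concatenation w_0 # w_1 # w_2 # ... with w_n a code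
   of q_n. *)
Definition codes_seq (s : stream) (q : nat -> rat) : Prop :=
  exists w : nat -> seq symbol,
    (forall n, codes_rat (w n) (q n)) /\
    (forall n, let pre := flatten [seq rcons (w i) Hash | i <- iota 0 n] in
       mkseq s (size pre) = pre).

(* [rep s x] means that [s] is a name of [x]. *)
Definition representation (R : realType) := stream -> R -> Prop.

Definition rho' (R : realType) : representation R := fun s x =>
  exists q : nat -> rat, codes_seq s q /\
    (fun n => ratr (q n) : R) @ \oo --> x.

(* The supremum and the infima are taken in the extended reals. *)
Definition rho'_lt (R : realType) (p : nat -> nat -> nat) : representation R :=
  fun s x => exists q : nat -> rat, codes_seq s q /\
    x%:E = ereal_sup (range (fun i =>
             ereal_inf (range (fun j => (ratr (q (p i j)) : R)%:E)))).

Definition rho'' (R : realType) (p : nat -> nat -> nat) : representation R :=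
  fun s x => exists q : nat -> rat, codes_seq s q /\
    exists y : nat -> R,
      (forall i, (fun j => ratr (q (p i j)) : R) @ \oo --> y i) /\
      y @ \oo --> x.

(** ** Computable real functions *)

Definition realizes (R : realType) (O : set (seq symbol)) (M : machine)
    (rep rep' : representation R) (f : R -> R) : Prop :=
  forall x s, rep s x -> exists t, computes O M s t /\ rep' t (f x).

Definition computable (R : realType) (rep rep' : representation R)
    (f : R -> R) : Prop :=
  exists M : machine, oracle_free M /\ realizes set0 M rep rep' f.

Definition computable_rel (R : realType) (O : set (seq symbol))
    (rep rep' : representation R) (f : R -> R) : Prop :=
  exists M : machine, realizes O M rep rep' f.

(* Main.v *)
(* A machine fixes each output digit after reading a finite prefix of its input,
   whatever the oracle.  Each part assumes that f violates the conclusion and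
   builds, one finite prefix at a time, a name of a single real that fools the
   machine:
   (a) if f z <= r < f x for z arbitrarily near x, the name of x is pieced
       together from beginnings of names of such z, stage k making the k-th
       output infimum at most some r' strictly between r and f x;
   (b) if x < y and f y < f x, the same is done with beginnings of names of y,
       row k being continued, once stage k is over, by a constant rational
       x_k < x, where the x_k tend to x;
   (c) rows must keep their limits, so the construction is a forcing argument.
       A condition is a finite prefix together with the limits of finitely many
       rows, each such row being constant beyond the prefix.  For r < r', any
       condition extends to one deciding that output row i is eventually <= r'
       or that it is eventually >= r: otherwise some name makes the row
       oscillate.  If f z > r' > r > f x for z near x, conditions aiming at such
       a z must decide ">= r" for arbitrarily late rows, and this survives when
       the next rows aim at x again; the resulting name of x has infinitely many
       output rows with limit >= r > f x. *)

From HB Require Import structures.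
Require Import Defs.
From mathcomp Require Import all_boot all_order all_algebra.
From mathcomp Require Import all_classical all_reals all_analysis.
From mathcomp Require Import lra.
Import Order.TTheory GRing.Theory Num.Theory.
Import numFieldNormedType.Exports.
Local Open Scope classical_set_scope.
Local Open Scope ring_scope.

Set Implicit Arguments.
Unset Strict Implicit.
Unset Printing Implicit Defensive.

(** * Finite use of the input by a machine *)

Definition agree {T : Type} (n : nat) (s s' : nat -> T) : Prop :=
  forall i, (i < n)%N -> s i = s' i.

Lemma agree_leq {T : Type} (m n : nat) (s s' : nat -> T) :
  (m <= n)%N -> agree n s s' -> agree m s s'.
Proof. by move=> mn ss' i im; apply: ss'; exact: leq_trans mn. Qed.

Lemma agree_mkseq {T : Type} (n : nat) (s s' : nat -> T) :
  mkseq s n = mkseq s' n <-> agree n s s'.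
Proof.
split=> [ss' i in_|ss'].
  by rewrite -(nth_mkseq (s 0%N) s in_) ss' nth_mkseq.
by apply/eq_in_map => i; rewrite mem_iota add0n => /andP[_]; exact: ss'.
Qed.

Lemma cpos_step_le O M s (c : config M) : (cpos (step O s c) <= (cpos c).+1)%N.
Proof.
rewrite /step; case: (query _) => [[yes no]|] /=; first exact: leqnSn.
by rewrite -addn1 leq_add2l leq_b1.
Qed.

Lemma cpos_iter_le O M s n : (cpos (iter n (step O s) (init M)) <= n)%N.
Proof.
elim: n => //= n IHn; apply: leq_trans (cpos_step_le _ _ _) _.
by rewrite ltnS.
Qed.

(** After [k] steps the input head has moved at most [k] cells, so [n] steps read only cells below
    [n]. *)
Lemma iter_step_agree O M s s' n : agree n s s' ->
  iter n (step O s) (init M) = iter n (step O s') (init M).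
Proof.
elim: n => //= n IHn ss'.
rewrite -IHn; last exact: agree_leq ss'.
rewrite /step; case: (query _) => [[//]|].
by rewrite ss' // ltnS; exact: cpos_iter_le.
Qed.

Lemma computes_agree O M s t m : computes O M s t ->
  exists N, forall s' t', computes O M s' t' -> agree N s s' -> agree m t t'.
Proof.
move=> [st mt]; have [n mn] := mt m; exists n => s' t' [st' _] ss'.
apply: (agree_leq mn); apply/agree_mkseq; rewrite -st.
by move: (st' n); rewrite /output_at -(iter_step_agree O M ss').
Qed.

(** * Unique decoding of rationals and of their sequences *)

(** The separator shown is the first on either side. Used with [Slash] inside a code and with [Hash]
    between codes. *)
Lemma cat_sep_inj {T : eqType} (a : T) (w w' z z' : seq T) :
  a \notin w -> a \notin w' -> w ++ a :: z = w' ++ a :: z' -> w = w' /\ z = z'.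
Proof.
elim: w w' => [|b w IHw] [|b' w'] //=.
- by move=> _ _ [].
- by rewrite !inE => _ /norP[/eqP aa' _] [].
- by rewrite !inE => /norP[/eqP aa' _] _ [/esym].
rewrite !inE => /norP[_ aw] /norP[_ aw'] [-> /(IHw _ aw aw')[-> ->]].
by [].
Qed.

Definition symbol_code (a : symbol) : nat :=
  match a with D0 => 0 | D1 => 1 | Minus => 2 | Slash => 3 | Hash => 4 end.

Definition symbol_decode (n : nat) : symbol :=
  match n with 0 => D0 | 1 => D1 | 2 => Minus | 3 => Slash | _ => Hash end.

Lemma symbol_codeK : cancel symbol_code symbol_decode. Proof. by case. Qed.

HB.instance Definition _ := Equality.copy symbol (can_type symbol_codeK).

Lemma digits_inj : injective digits.
Proof. by apply: inj_map => -[] []. Qed.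

Lemma mem_digits a u : a \in digits u -> a = D0 \/ a = D1.
Proof. by move=> /mapP[[] _ ->]; [right|left]. Qed.

Lemma mem_sign a (neg : bool) : a \in (if neg then [:: Minus] else [::]) -> a = Minus.
Proof. by case: neg => //; rewrite inE => /eqP. Qed.

Lemma codes_rat_Hash w q : codes_rat w q -> Hash \notin w.
Proof.
move=> [neg [u [v [_ _ -> _]]]]; apply/negP; rewrite !mem_cat inE.
by case/or4P=> [/mem_sign|/mem_digits[]|/eqP|/mem_digits[]].
Qed.

Lemma codes_rat_fun w q q' : codes_rat w q -> codes_rat w q' -> q = q'.
Proof.
move=> [neg [u [v [u0 _ -> ->]]]] [neg' [u' [v' [u'0 _ + ->]]]].
have noslash b x : Slash \notin (if b then [:: Minus] else [::]) ++ digits x.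
  by apply/negP; rewrite mem_cat => /orP[/mem_sign|/mem_digits[]].
rewrite !catA => /cat_sep_inj [//|//|+ /digits_inj ->].
case: neg neg' u u0 u' u'0 => -[] [|[] u] // _ [|[] u'] // _ [] //;
  by move=> /digits_inj ->.
Qed.

Lemma binval_rcons u b : binval (rcons u b) = (2 * binval u + b)%N.
Proof. by rewrite /binval foldl_rcons. Qed.

Lemma binval_surj n : exists u : seq bool, u <> [::] /\ binval u = n.
Proof.
elim/ltn_ind: n => -[_|n IHn]; first by exists [:: false].
have [|u [u0 un]] := IHn n.+1./2; first by rewrite ltn_half_double -addnn addSn ltnS leq_addl.
exists (rcons u (odd n.+1)); split; first by case: u {u0 un}.
by rewrite binval_rcons un mul2n addnC odd_double_half.
Qed.

Lemma codes_rat_ex q : exists w, codes_rat w q.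
Proof.
have [u [u0 un]] := binval_surj `|numq q|%N.
have [v [v0 vn]] := binval_surj `|denq q|%N.
exists ((if numq q < 0 then [:: Minus] else [::]) ++ digits u ++ Slash :: digits v).
exists (numq q < 0), u, v; split=> //.
  by rewrite vn; apply/eqP; rewrite absz_eq0 denq_eq0.
rewrite un vn -[LHS]divq_num_den mulrA; congr (_ / _).
  by rewrite [in LHS](intEsign (numq q)) rmorphM /= rmorph_sign.
by rewrite -[in LHS](gez0_abs (denq_ge0 q)).
Qed.

Definition blocks (w : nat -> seq symbol) (n : nat) : seq symbol :=
  flatten [seq rcons (w i) Hash | i <- iota 0 n].

Lemma blocksS w n : blocks w n.+1 = blocks w n ++ rcons (w n) Hash.
Proof. by rewrite /blocks -addn1 iotaD map_cat flatten_cat /= cats0. Qed.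

Lemma leq_size_blocks w n : (n <= size (blocks w n))%N.
Proof.
elim: n => // n IHn; rewrite blocksS size_cat size_rcons addnS ltnS.
exact: leq_trans IHn (leq_addr _ _).
Qed.

Lemma nth_blocks w m n i : (m <= n)%N -> (i < size (blocks w m))%N ->
  nth D0 (blocks w n) i = nth D0 (blocks w m) i.
Proof.
have blocks_cat k : exists z, blocks w (m + k) = blocks w m ++ z.
  elim: k => [|k [z zE]]; first by exists [::]; rewrite addn0 cats0.
  by exists (z ++ rcons (w (m + k)%N) Hash); rewrite addnS blocksS zE catA.
move=> mn im; have [z] := blocks_cat (n - m)%N.
by rewrite subnKC // => ->; rewrite nth_cat im.
Qed.

(** Each block ends in [Hash] and so is nonempty; hence symbol [n] lies in the first [n.+1]
    blocks. *)
Definition unblocks (w : nat -> seq symbol) : stream :=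
  fun n => nth D0 (blocks w n.+1) n.

Lemma unblocksP w n : mkseq (unblocks w) (size (blocks w n)) = blocks w n.
Proof.
apply: (@eq_from_nth _ D0); rewrite ?size_mkseq // => i iw.
rewrite nth_mkseq // /unblocks; case: (leqP i.+1 n) => [lein|ltni].
  by rewrite (nth_blocks lein) ?leq_size_blocks.
by rewrite (nth_blocks (ltnW ltni)).
Qed.

Definition rat_code (q : rat) : seq symbol := sval (cid (codes_rat_ex q)).

Definition encode (q : nat -> rat) : stream := unblocks (rat_code \o q).

Lemma codes_encode q : codes_seq (encode q) q.
Proof.
exists (rat_code \o q); split=> n; last exact: unblocksP.
by rewrite /= /rat_code; case: cid.
Qed.

Lemma encode_agree N q q' : agree N q q' -> agree N (encode q) (encode q').
Proof.
move=> qq' i iN; rewrite /encode /unblocks /blocks; congr (nth _ (flatten _) _).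
apply/eq_in_map => j; rewrite mem_iota add0n ltnS => /andP[_ ji].
by rewrite /= qq' // (leq_ltn_trans ji).
Qed.

Lemma blocks_prefix_eq w w' n : (forall i, Hash \notin w i) ->
  (forall i, Hash \notin w' i) -> prefix (blocks w n) (blocks w' n) ->
  forall i, (i < n)%N -> w i = w' i.
Proof.
move=> hw hw' /prefixP[z] zE i ilt.
(* The start [m] is generalised so that induction on [k] can peel off the first block. *)
suff : forall m k, prefix (flatten [seq rcons (w i) Hash | i <- iota m k])
    (flatten [seq rcons (w' i) Hash | i <- iota m k]) ->
    forall i, (m <= i < m + k)%N -> w i = w' i.
  by move=> /(_ 0%N n); apply; [apply/prefixP; exists z|].
move=> m k; elim: k m {zE ilt n z i} => [|k IHk] m.
  by move=> _ i; rewrite addn0 => /andP[/leq_ltn_trans H /H]; rewrite ltnn.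
move=> /prefixP[z] /=; rewrite -catA !cat_rcons => /esym.
move=> /cat_sep_inj[//|//|wm] zE i; rewrite leq_eqVlt.
case: eqVneq => [<- //|_ /= mi]; apply: (IHk m.+1); last by rewrite addSnnS.
by apply/prefixP; exists z.
Qed.

(** A prefix of [t] holding [m.+1] blocks suffices: both block texts are then prefixes of [t'], so
    one is a prefix of the other and the words between separators coincide. *)
Lemma codes_seq_continuous t a m : codes_seq t a ->
  exists N, forall t' a', codes_seq t' a' -> agree N t t' -> a' m = a m.
Proof.
move=> [w [wa tw]]; exists (size (blocks w m.+1)) => t' a' [w' [wa' tw']] tt'.
have hw i : Hash \notin w i by exact: codes_rat_Hash (wa i).
have hw' i : Hash \notin w' i by exact: codes_rat_Hash (wa' i).
have pre (k l : nat) : (k <= l)%N -> prefix (mkseq t' k) (mkseq t' l).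
  move=> kl; apply/prefixP; exists (map t' (iota k (l - k))).
  by rewrite /mkseq -map_cat -{2}[k]add0n -iotaD subnKC.
suff wE : w m = w' m by apply: codes_rat_fun (wa' m) _; rewrite -wE.
have E1 : mkseq t' (size (blocks w m.+1)) = blocks w m.+1.
  by rewrite -(proj2 (agree_mkseq _ _ _) tt'); exact: tw.
have E2 : mkseq t' (size (blocks w' m.+1)) = blocks w' m.+1 by exact: tw'.
case/orP: (leq_total (size (blocks w m.+1)) (size (blocks w' m.+1))) => /pre.
  by rewrite E1 E2 => /blocks_prefix_eq; apply.
by rewrite E1 E2 => /blocks_prefix_eq /(_ _ (ltnSn m)) ->.
Qed.

(** * Continuous relations on rational sequences *)

Definition seq_rel := (nat -> rat) -> (nat -> rat) -> Prop.

(** The case [q' = q] makes [a] unique: this is a partial map, continuous for the product of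
    discrete topologies. *)
Definition seq_continuous (Phi : seq_rel) : Prop := forall q a m, Phi q a ->
  exists N, forall q' a', Phi q' a' -> agree N q q' -> a' m = a m.

Definition machine_rel (O : set (seq symbol)) (M : machine) : seq_rel :=
  fun q a => exists t, computes O M (encode q) t /\ codes_seq t a.

Lemma machine_rel_continuous O M : seq_continuous (machine_rel O M).
Proof.
move=> q a m [t [qt ta]]; have [N tN] := codes_seq_continuous m ta.
have [K qK] := computes_agree N qt.
exists K => q' a' [t' [qt' ta']] qq'.
by apply: tN ta' _; apply: qK qt' _; exact: encode_agree.
Qed.

Lemma realizes_machine_rel (R : realType) (O : set (seq symbol)) (M : machine)
    (D D' : (nat -> rat) -> R -> Prop) (f : R -> R) :
  realizes O M (fun s x => exists q, codes_seq s q /\ D q x)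
    (fun s x => exists q, codes_seq s q /\ D' q x) f ->
  forall x q, D q x -> exists a, machine_rel O M q a /\ D' a (f x).
Proof.
move=> Mf x q qx; have [|t [qt [a [ta ax]]]] := Mf x (encode q).
  by exists q; split=> //; exact: codes_encode.
by exists a; split=> //; exists t.
Qed.

(** * Boxes, forcing and fusion *)

Definition in_box (Z : nat -> set rat) (q : nat -> rat) : Prop :=
  forall n, Z n (q n).

Definition forces (Phi : seq_rel) (Z : nat -> set rat)
    (P : (nat -> rat) -> Prop) : Prop :=
  forall q a, in_box Z q -> Phi q a -> P a.

Lemma forces_subset Phi (Z Z' : nat -> set rat) P :
  (forall n, Z' n `<=` Z n) -> forces Phi Z P -> forces Phi Z' P.
Proof. by move=> Z'Z ZP q a qZ'; apply: ZP => n; exact: Z'Z. Qed.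

(** Stage [k] leaves at most one value in each coordinate up to [k], so a single sequence lies in
    all the nested boxes and inherits what any stage forces. [E k] records what stage [k]
    achieves. *)
Lemma fusion (S : Type) (box : S -> nat -> set rat) (Inv : S -> Prop)
    (E : nat -> S -> S -> Prop) (s0 : S) :
  Inv s0 -> (forall s, Inv s -> forall n, box s n !=set0) ->
  (forall k s, Inv s -> exists s', [/\ Inv s', E k s s',
    forall n, box s' n `<=` box s n &
    forall n, (n <= k)%N -> is_subset1 (box s' n)]) ->
  exists (s_ : nat -> S) (q : nat -> rat), s_ 0%N = s0 /\
    forall k, [/\ Inv (s_ k), E k (s_ k) (s_ k.+1) & in_box (box (s_ k)) q].
Proof.
move=> Inv0 box0 next_ex.
have /choice[g gP] : forall ks : nat * {s | Inv s}, exists s' : {s | Inv s},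
    [/\ E ks.1 (sval ks.2) (sval s'),
      forall n, box (sval s') n `<=` box (sval ks.2) n &
      forall n, (n <= ks.1)%N -> is_subset1 (box (sval s') n)].
  by move=> [k [s sI]]; have [s' [s'I ? ? ?]] := next_ex k s sI; exists (exist _ s' s'I).
pose t := nat_rect (fun=> {s | Inv s}) (exist _ s0 Inv0) (fun k s => g (k, s)).
have tS k : t k.+1 = g (k, t k) by [].
have tI k : Inv (sval (t k)) by case: (t k).
have sub k l n : (k <= l)%N -> box (sval (t l)) n `<=` box (sval (t k)) n.
  move=> /subnK <-; elim: (l - k)%N => // m; apply: subset_trans.
  by rewrite addSn tS; have [_ + _] := gP ((m + k)%N, t (m + k)%N); exact.
(* Stage [n.+1] is the first at which coordinate [n] is guaranteed to have a single value. *)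
have /choice[q qP] n := box0 _ (tI n.+1) n.
exists (sval \o t), q; split=> // k; split=> //=.
  by have [] := gP (k, t k).
move=> n; case: (leqP k n.+1) => [kn|nk]; first exact: sub (qP n).
have [u uk] := box0 _ (tI k) n.
have [_ _ /(_ n (leqnn n)) one] := gP (n, t n).
by rewrite (one (q n) u (qP n)) //; exact: sub (ltnW nk) _ uk.
Qed.

Definition pin (N : nat) (q : nat -> rat) (Z : nat -> set rat) :
    nat -> set rat :=
  fun n => if (n < N)%N then [set q n] else Z n.

Lemma pin_subset N q Z N' q' Z' n : (N <= N')%N -> in_box (pin N q Z) q' ->
  ((N <= n)%N -> Z' n `<=` Z n) -> pin N' q' Z' n `<=` pin N q Z n.
Proof.
move=> NN' q'Z Z'Z u; rewrite {1}/pin; case: ltnP => [_ ->|N'n Z'u]; first exact: q'Z.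
by rewrite /pin ltnNge (leq_trans NN' N'n) /=; apply: Z'Z Z'u; exact: leq_trans N'n.
Qed.

Lemma pin_subset1 N q Z n : (n < N)%N -> is_subset1 (pin N q Z n).
Proof. by rewrite /pin => -> u v -> ->. Qed.

Lemma pin_nonempty N q Z : (forall n, Z n !=set0) -> forall n, pin N q Z n !=set0.
Proof. by move=> Z0 n; rewrite /pin; case: ltnP => // _; exists (q n). Qed.

Lemma pin_if N q q' Z : (forall n, (N <= n)%N -> Z n (q' n)) ->
  in_box (pin N q Z) (fun n => if (n < N)%N then q n else q' n).
Proof. by move=> q'Z n; rewrite /pin; case: ltnP => // /q'Z. Qed.

Lemma forces_pin Phi q a m : seq_continuous Phi -> Phi q a ->
  exists N, forall N' Z, (N <= N')%N ->
    forces Phi (pin N' q Z) (fun a' => a' m = a m).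
Proof.
move=> cPhi qa; have [N NP] := cPhi _ _ m qa; exists N => N' Z NN' q' a' q'Z.
move=> /NP; apply=> n nN; have := q'Z n.
by rewrite /pin (leq_trans nN NN').
Qed.

(** * Limits and rational approximation *)

Lemma cvg_seqP (R : realType) (u : nat -> R) (l : R) :
  u @ \oo --> l <-> forall e, 0 < e ->
    exists N, forall n, (N <= n)%N -> `|l - u n| < e.
Proof.
rewrite cvgrPdist_lt; split=> ul e /ul.
  by case=> N _ NP; exists N => n /NP.
by case=> N NP; exists N => // n /= /NP.
Qed.

Lemma cvg_seq_le (R : realType) (u : nat -> R) (l r : R) : u @ \oo --> l ->
  (forall N, exists2 n, (N <= n)%N & u n <= r) -> l <= r.
Proof.
move=> /cvg_seqP ul ur; rewrite leNgt; apply/negP => rl.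
have [|N NP] := ul (l - r); first by rewrite subr_gt0.
have [n /NP + unr] := ur N.
by rewrite ltr_distlC; lra.
Qed.

Lemma cvg_seq_ge (R : realType) (u : nat -> R) (l r : R) : u @ \oo --> l ->
  (forall N, exists2 n, (N <= n)%N & r <= u n) -> r <= l.
Proof.
move=> /cvgN ul ur; rewrite -lerN2; apply: cvg_seq_le ul _ => N.
by have [n Nn run] := ur N; exists n => //; rewrite lerN2.
Qed.

Lemma invS_lt (R : realType) (e : R) : 0 < e ->
  exists N, forall n, (N <= n)%N -> n.+1%:R^-1 < e.
Proof. by move=> e0; have [N _ NP] := near_infty_natSinv_lt (PosNum e0); exists N. Qed.

Lemma rat_between (R : realType) (x y : R) : x < y ->
  exists u : rat, x < ratr u < y.
Proof. by move=> /rat_in_itvoo[u]; rewrite in_itv; exists u. Qed.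

Lemma rat_seq_cvg (R : realType) (x e : R) : 0 < e ->
  exists u : nat -> rat, (fun n => ratr (u n) : R) @ \oo --> x /\
    forall n, `|x - ratr (u n)| < e.
Proof.
move=> e0; have /choice[u uP] : forall n : nat, exists u : rat,
    `|x - ratr u| < Num.min e n.+1%:R^-1.
  move=> n; set d := Num.min _ _.
  have d0 : 0 < d by rewrite lt_min e0 invr_gt0 ltr0n.
  have [u xud] : exists u : rat, x - d < ratr u < x + d by apply: rat_between; lra.
  by exists u; rewrite ltr_distlC.
exists u; split=> [|n]; last by have := uP n; rewrite lt_min => /andP[].
apply/cvg_seqP => d /invS_lt[N NP]; exists N => n /NP.
by have := uP n; rewrite lt_min => /andP[_]; exact: lt_trans.
Qed.

(** * Sup-inf names and lower semicontinuity *)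

Definition lt_name (R : realType) (p : nat -> nat -> nat) (q : nat -> rat)
    (x : R) : Prop :=
  x%:E = ereal_sup (range (fun i =>
           ereal_inf (range (fun j => (ratr (q (p i j)) : R)%:E)))).

(** The first conjunct says that no row infimum exceeds [x], the second that row infima come
    arbitrarily close to [x]; later arguments thus avoid extended reals. *)
Lemma lt_nameP (R : realType) p q (x : R) : lt_name p q x <->
  (forall i r, x < r -> exists j, (ratr (q (p i j)) : R) < r) /\
  (forall r, r < x -> exists i, forall j, r <= (ratr (q (p i j)) : R)).
Proof.
rewrite /lt_name; set I := fun i => ereal_inf _; split=> [xE|[xlt ltx]].
  split=> [i r xr|r rx].
    have : (I i < r%:E)%E.
      apply: le_lt_trans (_ : (x%:E < r%:E)%E); last by rewrite lte_fin.
      by rewrite xE; apply: ereal_sup_ubound; exists i.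
    by move=> /ereal_inf_lt[_ [j _ <-]]; rewrite lte_fin; exists j.
  have : (r%:E < ereal_sup (range I))%E by rewrite -xE lte_fin.
  move=> /ereal_sup_gt[_ [i _ <-] rI]; exists i => j.
  rewrite -lee_fin; apply: le_trans (ltW rI) _.
  by apply: ereal_inf_lbound; exists j.
apply/eqP; rewrite eq_le; apply/andP; split.
  apply/lee_subgt0Pr => e e0; have [|i iP] := ltx (x - e); first by lra.
  apply: le_ereal_sup_tmp; exists (I i); first by exists i.
  by apply: le_ereal_inf_tmp => _ [j _ <-]; rewrite lee_fin.
apply: ge_ereal_sup => _ [i _ <-]; apply/lee_addgt0Pr => e e0.
have [|j jP] := xlt i (x + e); first by lra.
apply: ge_ereal_inf; exists (ratr (q (p i j)))%:E; first by exists j.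
by rewrite lee_fin ltW.
Qed.

Lemma lt_realizer_lsc (R : realType) (p : nat -> nat -> nat) (Phi : seq_rel)
    (f : R -> R) : seq_continuous Phi ->
  (forall x q, (fun n => ratr (q n) : R) @ \oo --> x ->
    exists a, Phi q a /\ lt_name p a (f x)) ->
  forall x r, r < f x -> \forall z \near x, r < f z.
Proof.
move=> cPhi Phif x r rfx; apply: contrapT => nlsc.
have freq e : 0 < e -> exists2 z, `|x - z| < e & f z <= r.
  move=> e0; apply: contrapT => no; apply: nlsc.
  exists e => //= z xz; rewrite ltNge; apply/negP => fzr; apply: no.
  by exists z.
pose r' := (r + f x) / 2.
(* An infimum at most [r] yields a single entry below [r'], which a finite prefix can force. *)
have [rr' r'fx] : r < r' /\ r' < f x by rewrite /r'; split; lra.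
(* A stage [(q, N, e)] fixes the first [N] entries of [q] and keeps later ones within [1/(e+1)] of
   [x]. *)
pose box (s : (nat -> rat) * nat * nat) := pin s.1.2 s.1.1
  (fun=> [set u : rat | `|x - ratr u| < s.2.+1%:R^-1]).
pose E k (s s' : (nat -> rat) * nat * nat) := (k <= s'.2)%N /\
  forces Phi (box s') (fun a => exists j, (ratr (a (p k j)) : R) < r').
have inv_gt0 n : 0 < n.+1%:R^-1 :> R by rewrite invr_gt0 ltr0n.
have [] := @fusion _ box (fun=> True) E (fun=> 0, 0%N, 0%N) I.
- move=> s _; apply: pin_nonempty => _.
  have [u [_ /(_ 0%N) ?]] := rat_seq_cvg x (inv_gt0 s.2).
  by exists (u 0%N).
- move=> k [[q N] e] _; pose e' := maxn e k.
  have [z xz fzr] := freq _ (inv_gt0 e').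
  (* This is the room left by [z] in the ball around [x]: entries that close to [z] stay in the
     box. *)
  have d0 : 0 < e'.+1%:R^-1 - `|x - z| by rewrite subr_gt0.
  have [u [uz uP]] := rat_seq_cvg z d0.
  pose q' n := if (n < N)%N then q n else u n.
  have q'z : (fun n => ratr (q' n) : R) @ \oo --> z.
    apply/cvg_seqP => d d0'; move/cvg_seqP: uz => /(_ d d0')[K KP].
    exists (maxn K N) => n; rewrite geq_max => /andP[Kn Nn].
    by rewrite /q' ltnNge Nn /=; exact: KP.
  have [a [q'a /lt_nameP[/(_ k r') + _]]] := Phif _ _ q'z.
  move=> /(_ (le_lt_trans fzr rr'))[j ajr'].
  have [K KP] := forces_pin (p k j) cPhi q'a.
  have ee' : e'.+1%:R^-1 <= e.+1%:R^-1 :> R.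
    by rewrite lef_pV2 ?posrE ?ltr0n // ler_nat ltnS leq_maxl.
  (* The new length keeps the old prefix, fixes coordinate [k] and covers the input that determines
     output entry [p k j]. *)
  exists (q', maxn (maxn N k.+1) K, e'); split=> //.
  + split; first exact: leq_maxr.
    move=> q'' a'' /KP H /H; rewrite leq_maxr => /(_ isT) aE.
    by exists j; rewrite aE.
  + move=> n; apply: pin_subset => /=.
    * by rewrite -maxnA leq_maxl.
    * apply: pin_if => m _ /=; apply: lt_le_trans ee'.
      by apply: le_lt_trans (ler_distD z _ _) _; rewrite -ltrBrDl.
    * by move=> _ v /= /lt_le_trans; apply.
  + move=> n nk; apply: pin_subset1 => /=.
    by rewrite leq_max leq_max ltnS nk orbT.
move=> s_ [q [_ sP]].
have qx : (fun n => ratr (q n) : R) @ \oo --> x.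
  apply/cvg_seqP => e /invS_lt[k kP]; have [_ [ks _] _] := sP k.
  have [_ _ qs] := sP k.+1; exists (s_ k.+1).1.2 => n sn.
  by have := qs n; rewrite /box /pin ltnNge sn /= => /lt_trans; apply; exact: kP.
have [a [qa /lt_nameP[_ /(_ r' r'fx)[k kP]]]] := Phif _ _ qx.
have [_ [_ forc] _] := sP k; have [_ _ qs] := sP k.+1.
by have [j] := forc q a qs qa; rewrite ltNge kP.
Qed.

(** * Injective pairings *)

Definition pairing (p : nat -> nat -> nat) : Prop :=
  forall i j i' j', p i j = p i' j' -> i = i' /\ j = j'.

(** By injectivity each number below [N] excludes at most one pair. So a finite prefix meets
    finitely many rows, each in finitely many entries. *)
Lemma pairing_large p : pairing p -> forall N, exists K, forall i j,
  (K <= i)%N || (K <= j)%N -> (N <= p i j)%N.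
Proof.
move=> pI; elim=> [|N [K KP]]; first by exists 0%N.
have [[[i0 j0] /= pN]|no] := pselect (exists ij, p ij.1 ij.2 = N).
  exists (maxn K (maxn i0 j0).+1) => i j.
  rewrite !geq_max => ij; rewrite ltn_neqAle; apply/andP; split.
    apply: contraTN ij => /eqP; rewrite -pN => /pI[-> ->].
    by rewrite !gtn_max !ltnn !andbF.
  by apply: KP; case/orP: ij => /andP[->] //; rewrite orbT.
exists K => i j /KP; rewrite leq_eqVlt => /orP[/eqP NE|//].
by case: no; exists (i, j).
Qed.

Lemma pairing_row p : pairing p -> exists row, forall i j, row (p i j) = i.
Proof.
move=> pI; have /choice[row rowP] : forall n, exists i, forall i' j, p i' j = n -> i' = i.
  move=> n; have [[[i j] /= pn]|no] := pselect (exists ij, p ij.1 ij.2 = n).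
    by exists i => i' j'; rewrite -pn => /pI[].
  by exists 0%N => i j pn; case: no; exists (i, j).
by exists row => i j; apply/esym/(rowP _ i j).
Qed.

(** * Monotonicity for sup-inf names *)

Lemma lt_realizer_homo (R : realType) (p : nat -> nat -> nat) (Phi : seq_rel)
    (f : R -> R) : pairing p -> seq_continuous Phi ->
  (forall x q, lt_name p q x -> exists a, Phi q a /\ lt_name p a (f x)) ->
  {homo f : x y / x <= y}.
Proof.
move=> pI cPhi Phif x y; rewrite le_eqVlt => /orP[/eqP -> //|xy].
rewrite leNgt; apply/negP => fyx.
have [row rowK] := pairing_row pI; have plarge := pairing_large pI.
pose r := (f y + f x) / 2.
have [fyr rfx] : f y < r /\ r < f x by rewrite /r; split; lra.
have inv_gt0 n : 0 < n.+1%:R^-1 :> R by rewrite invr_gt0 ltr0n.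
have /choice[xs xsP] : forall n, exists u : rat, x - n.+1%:R^-1 < ratr u < x.
  by move=> n; apply: rat_between; rewrite ltrBlDr ltrDl.
(* The bound [x] puts [ys] above every [xs], so mixing both in row [i] never takes its infimum below
   [xs i]. *)
have /choice[ys ysP] : forall n, exists u : rat,
    Num.max x (y - n.+1%:R^-1) < ratr u < y.
  by move=> n; apply: rat_between; rewrite gt_max xy ltrBlDr ltrDl /=.
(* Rows below [B] are closed and admit only [xs]; the others may still use [ys]. Raising [B] shrinks
   the box. *)
pose A B : nat -> set rat := fun n =>
  [set u | u = xs (row n) \/ (B <= row n)%N /\ u = ys (row n)].
have A_ge_xs B n u : A B n u -> ratr (xs (row n)) <= ratr u :> R.
  case=> [->|[_ ->]]; first exact: lexx.
  have /andP[_ xsx] := xsP (row n).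
  have /andP[+ _] := ysP (row n); rewrite gt_max => /andP[xys _].
  by rewrite ltW // (lt_trans xsx).
pose box (s : (nat -> rat) * nat * nat) := pin s.1.2 s.1.1 (A s.2).
pose E k (s s' : (nat -> rat) * nat * nat) := (k < s'.2)%N /\
  forces Phi (box s') (fun a => exists j, (ratr (a (p k j)) : R) < r).
have [] := @fusion _ box (fun s => in_box (A 0%N) s.1.1) E (xs \o row, 0%N, 0%N).
- by move=> n; left.
- by move=> s _; apply: pin_nonempty => n; exists (xs (row n)); left.
- move=> k [[q N] B] /= qA.
  (* This continuation aims at [y]: only the finitely many closed rows use [xs]. *)
  pose t n := if (row n < B)%N then xs (row n) else ys (row n).
  have tA n : A B n (t n) by rewrite /t /A /=; case: ltnP; [left|right].
  pose q' n := if (n < N)%N then q n else t n.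
  have q'A n : A 0%N n (q' n).
    rewrite /q'; case: ltnP => _; first exact: qA.
    by case: (tA n) => [|[_ ?]]; [left|right].
  have A_lt_y n u : A 0%N n u -> (ratr u : R) < y.
    case=> [|[_]] ->; last by have /andP[] := ysP (row n).
    by have /andP[_ /lt_trans] := xsP (row n); apply.
  have q'y : lt_name p q' y.
    apply/lt_nameP; split=> [i s ys'|s sy].
      by exists 0%N; apply: lt_trans ys'; exact: A_lt_y (q'A _).
    (* Late rows are open and lie wholly beyond the prefix, so they are constantly [ys i]. *)
    have [K KP] := plarge N.
    have [L LP] := @invS_lt R (y - s) ltac:(by rewrite subr_gt0).
    exists (maxn B (maxn K L)) => j; set i := maxn B _.
    have Npij : (N <= p i j)%N by apply: KP; rewrite !leq_max leqnn !orbT.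
    rewrite /q' ltnNge Npij /= /t rowK ltnNge leq_maxl /=.
    have := LP i; rewrite !leq_max leqnn !orbT => /(_ isT) Li.
    have /andP[+ _] := ysP i; rewrite gt_max => /andP[_ /ltW]; apply: le_trans.
    by rewrite lerBrDr -lerBrDl ltW.
  have [a [q'a /lt_nameP[/(_ k r fyr)[j ajr] _]]] := Phif _ _ q'y.
  have [K KP] := forces_pin (p k j) cPhi q'a.
  exists (q', maxn (maxn N k.+1) K, maxn B k.+1); split=> //=.
  + split; first by rewrite leq_max ltnSn orbT.
    move=> q'' a'' /KP H /H; rewrite leq_maxr => /(_ isT) aE.
    by exists j; rewrite aE.
  + move=> n; apply: pin_subset => /=.
    * by rewrite -maxnA leq_maxl.
    * exact: pin_if.
    * by move=> _ u [->|[]]; [left|rewrite geq_max => /andP[? _]; right].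
  + move=> n nk; apply: pin_subset1 => /=.
    by rewrite leq_max leq_max ltnS nk orbT.
move=> s_ [q [s0 sP]].
have qA n : A 0%N n (q n) by have [_ _ /(_ n)] := sP 0%N; rewrite s0.
have qx : lt_name p q x.
  apply/lt_nameP; split=> [i s xs'|s sx].
    (* Stage [i] closes row [i], so past the prefix then fixed the row equals [xs i < x]. *)
    have [_ [is' _] _] := sP i; have [_ _ qi] := sP i.+1.
    have [K KP] := plarge (s_ i.+1).1.2; exists K.
    have := qi (p i K); rewrite /box /pin ltnNge KP ?leqnn ?orbT //= => -[->|[]].
      by rewrite rowK; have /andP[_ /lt_trans] := xsP i; apply.
    by rewrite rowK leqNgt is'.
  have [L LP] := @invS_lt R (x - s) ltac:(by rewrite subr_gt0).
  exists L => j; apply: le_trans (A_ge_xs _ _ _ (qA (p L j))).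
  rewrite rowK; have /andP[/ltW + _] := xsP L; apply: le_trans.
  by rewrite lerBrDr -lerBrDl ltW // LP.
have [a [qa /lt_nameP[_ /(_ r rfx)[k kP]]]] := Phif _ _ qx.
have [_ [_ forc] _] := sP k; have [_ _ qs] := sP k.+1.
by have [j] := forc q a qs qa; rewrite ltNge kP.
Qed.

(** * Conditions for double-limit names *)

Definition limlim_name (R : realType) (p : nat -> nat -> nat) (q : nat -> rat)
    (x : R) : Prop :=
  exists y : nat -> R,
    (forall i, (fun j => ratr (q (p i j)) : R) @ \oo --> y i) /\ y @ \oo --> x.

(* Row i is forced to equal [cval c i] beyond the prefix of length [clen c] when
   i < [crow c]; the values of [cseq c] from [clen c] on and of [cval c] from
   [crow c] on are irrelevant. *)
Record condition := Condition {
  cseq : nat -> rat; clen : nat; cval : nat -> rat; crow : nat }.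

Definition cbox (row : nat -> nat) (c : condition) : nat -> set rat :=
  pin (clen c) (cseq c)
    (fun n => [set u | (row n < crow c)%N -> u = cval c (row n)]).

(* Only the newly committed row limits must lie in [W]; the new entries of the
   prefix are unconstrained, since they do not affect the limit of a row. *)
Definition extends (R : realType) (row : nat -> nat) (W : set R)
    (c c' : condition) : Prop :=
  [/\ forall n, cbox row c' n `<=` cbox row c n, (crow c <= crow c')%N,
    agree (crow c) (cval c) (cval c') &
    forall i, (crow c <= i < crow c')%N -> W (ratr (cval c' i))].

Lemma extends_refl (R : realType) row (W : set R) c : extends row W c c.
Proof. by split=> // [i|i /andP[/leq_ltn_trans H /H]] //; rewrite ltnn. Qed.

Lemma extends_trans (R : realType) row (W : set R) c1 c2 c3 :
  extends row W c1 c2 -> extends row W c2 c3 -> extends row W c1 c3.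
Proof.
move=> [b12 r12 v12 W12] [b23 r23 v23 W23]; split.
- by move=> n; exact: subset_trans (b12 n).
- exact: leq_trans r23.
- by move=> i i1; rewrite v12 // v23 // (leq_trans i1).
- move=> i /andP[i1 i3]; case: (ltnP i (crow c2)) => i2; last by apply: W23; rewrite i2.
  by rewrite -v23 //; apply: W12; rewrite i1.
Qed.

Lemma extends_subset (R : realType) row (V W : set R) c c' : V `<=` W ->
  extends row V c c' -> extends row W c c'.
Proof. by move=> VW [? ? ? cV]; split=> // i /cV /VW. Qed.

Lemma forces_extends (R : realType) row (W : set R) c c' Phi P :
  extends row W c c' -> forces Phi (cbox row c) P -> forces Phi (cbox row c') P.
Proof. by case=> sub _ _ _; exact: forces_subset. Qed.

Lemma extends_commit (R : realType) row (W : set R) c u k : W (ratr u) ->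
  exists c', [/\ extends row W c c', (k < clen c')%N & (crow c < crow c')%N].
Proof.
move=> Wu.
(* Committed rows must keep their values in the lengthened prefix; in other rows this filling is
   arbitrary. *)
pose q n := if (n < clen c)%N then cseq c n else cval c (row n).
pose v i := if i == crow c then u else cval c i.
exists (Condition q (maxn (clen c) k.+1) v (crow c).+1); split=> //=; last first.
  by rewrite leq_maxr.
split=> //=.
- move=> n; apply: pin_subset => /=; [exact: leq_maxl|exact: pin_if|].
  move=> _ w /= wv rn; rewrite wv; last exact: ltnW.
  by rewrite /v ltn_eqF.
- by move=> i ic; rewrite /v ltn_eqF.
- by move=> i; rewrite ltnS -eqn_leq => /eqP <-; rewrite /v eqxx.
Qed.

Lemma extends_force (R : realType) row (W : set R) c Phi q a m :
  seq_continuous Phi -> in_box (cbox row c) q -> Phi q a ->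
  exists c', extends row W c c' /\
    forces Phi (cbox row c') (fun a' => a' m = a m).
Proof.
move=> cPhi qc qa; have [K KP] := forces_pin m cPhi qa.
exists (Condition q (maxn (clen c) K) (cval c) (crow c)); split.
  split=> //= [n|i /andP[/leq_ltn_trans H /H]]; last by rewrite ltnn.
  by apply: pin_subset => [|//|_ //]; exact: leq_maxl.
by apply: KP; exact: leq_maxr.
Qed.

(** Stage [k] forces [P k], then commits one more row. All rows committed there get limits in [W]
    and within [1/(k+1)] of [x], so fusion yields a name of [x]. *)
Lemma generic_name (R : realType) (p : nat -> nat -> nat) row Phi
    (W : set R) (x : R) c0 (P : nat -> (nat -> rat) -> Prop) :
  pairing p -> (forall i j, row (p i j) = i) -> nbhs x W ->
  (forall k c V, V `<=` W -> nbhs x V -> extends row W c0 c ->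
    exists c', extends row V c c' /\ forces Phi (cbox row c') (P k)) ->
  exists q, limlim_name p q x /\ forall a, Phi q a -> forall k, P k a.
Proof.
move=> pI rowK Wx step_ex; have plarge := pairing_large pI.
pose U k : set R := [set z | `|x - z| < k.+1%:R^-1].
have Ux k : nbhs x (U k).
  by exists k.+1%:R^-1 => //=; rewrite invr_gt0 ltr0n.
pose E k c c' := [/\ extends row (W `&` U k) c c', (crow c < crow c')%N &
  forces Phi (cbox row c') (P k)].
have [|c _ n|k c c0c|c_ [q [_ cP]]] :=
    @fusion _ (cbox row) (extends row W c0) E c0.
- exact: extends_refl.
- by apply: pin_nonempty => m; exists (cval c (row m)).
- have [||c1 [cc1 c1P]] := step_ex k c (W `&` U k) _ _ c0c.
  + by move=> z [].
  + exact: filterI.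
  have [e /= e0 eWU] : nbhs x (W `&` U k) by exact: filterI.
  have [u [_ /(_ 0%N)/eWU WUu]] := rat_seq_cvg x e0.
  have [c' [c1c' lec' c1row]] := extends_commit row c1 k WUu.
  have cc' := extends_trans cc1 c1c'; have [sub r1 _ _] := cc1.
  exists c'; split.
  + by apply: extends_trans c0c _; apply: extends_subset cc' => z [].
  + split=> //; first exact: leq_ltn_trans c1row.
    exact: forces_extends c1c' c1P.
  + by case: cc'.
  + by move=> n nk; apply: pin_subset1; exact: leq_ltn_trans lec'.
exists q; split; last first.
  move=> a qa k; have [_ [_ _ forc] _] := cP k; have [_ _ qk] := cP k.+1.
  exact: forc qk qa.
have c_row k : (k <= crow (c_ k))%N.
  elim: k => // k IHk; have [_ [_ + _] _] := cP k; exact: leq_ltn_trans.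
have c_ext K l : (K <= l)%N -> extends row (U K) (c_ K) (c_ l).
  move=> /subnK <-; elim: (l - K)%N => [|m IHm]; first exact: extends_refl.
  rewrite addSn; apply: extends_trans IHm _.
  have [_ [+ _ _] _] := cP (m + K)%N; apply: extends_subset => z [_ /= zU].
  apply: lt_le_trans zU _.
  by rewrite lef_pV2 ?posrE ?ltr0n // ler_nat ltnS leq_addl.
(* By stage [i.+1] at least [i.+1] rows are committed, so row [i] already has its final limit. *)
exists (fun i => ratr (cval (c_ i.+1) i)); split=> [i|].
  have [K KP] := plarge (clen (c_ i.+1)).
  apply/cvg_seqP => e e0; exists K => j Kj.
  have [_ _ /(_ (p i j))] := cP i.+1.
  rewrite /cbox /pin ltnNge KP ?Kj ?orbT //= rowK => -> //.
  by rewrite subrr normr0.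
apply/cvg_seqP => e /invS_lt[K KP]; exists (crow (c_ K)) => i Ki.
(* Row [i] is not yet committed at stage [K], so its limit is later chosen in [U K]. *)
have [|_ _ _ /(_ i)] := c_ext K i.+1.
  by apply: leqW; exact: leq_trans Ki.
rewrite Ki c_row => /(_ isT) /= UK; apply: lt_trans UK _; exact: KP.
Qed.

(** * Deciding output rows, and continuity *)

Definition row_eventually_le (R : realType) (p : nat -> nat -> nat) (i : nat) (r : R)
    (a : nat -> rat) : Prop :=
  exists J, forall j, (J <= j)%N -> ratr (a (p i j)) <= r.

Definition row_eventually_ge (R : realType) (p : nat -> nat -> nat) (i : nat) (r : R)
    (a : nat -> rat) : Prop :=
  exists J, forall j, (J <= j)%N -> r <= ratr (a (p i j)).

(** If nothing above [c] decides the row, any extension can still be made to force an entry [>= r']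
    and one [<= r] arbitrarily far out; a generic name of [x] then yields an output row without
    limit. *)
Lemma decide_row (R : realType) (p : nat -> nat -> nat) row Phi (f : R -> R)
    (W : set R) (x : R) c i (r r' : R) :
  pairing p -> (forall i j, row (p i j) = i) -> seq_continuous Phi ->
  (forall x q, limlim_name p q x -> exists a, Phi q a /\ limlim_name p a (f x)) ->
  nbhs x W -> r < r' ->
  exists c', extends row W c c' /\
    (forces Phi (cbox row c') (row_eventually_le p i r') \/
     forces Phi (cbox row c') (row_eventually_ge p i r)).
Proof.
move=> pI rowK cPhi Phif Wx rr'; apply: contrapT => no.
pose P k (a : nat -> rat) :=
  (exists2 j, (k <= j)%N & r' <= ratr (a (p i j))) /\
  (exists2 j, (k <= j)%N & ratr (a (p i j)) <= r).
have not_forced (b : (nat -> rat) -> Prop) c' :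
    ~ forces Phi (cbox row c') b -> exists q a,
      [/\ in_box (cbox row c') q, Phi q a & ~ b a].
  move=> nb; apply: contrapT => nex; apply: nb => q a qc qa.
  by apply: contrapT => nba; apply: nex; exists q, a.
have [|q [qx qP]] := @generic_name R p row Phi W x c P pI rowK Wx.
- move=> k c1 V VW Vx cc1.
  have {}no c' : extends row V c1 c' ->
      ~ forces Phi (cbox row c') (row_eventually_le p i r') /\
      ~ forces Phi (cbox row c') (row_eventually_ge p i r).
    move=> c1c'; have cc' := extends_trans cc1 (extends_subset VW c1c').
    by split=> fc; apply: no; exists c'; split=> //; [left|right].
  have [/not_forced[q [a [qc qa nlow]]] _] := no c1 (extends_refl _ _ _).
  have [j kj aj] : exists2 j, (k <= j)%N & r' <= ratr (a (p i j)).
    apply: contrapT => nj; apply: nlow; exists k => j kj.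
    by rewrite leNgt; apply/negP => /ltW aj; apply: nj; exists j.
  have [c2 [c12 c2j]] := extends_force V (p i j) cPhi qc qa.
  have [_ /not_forced[q' [a' [qc' qa' nhigh]]]] := no c2 c12.
  have [j' kj' aj'] : exists2 j, (k <= j)%N & ratr (a' (p i j)) <= r.
    apply: contrapT => nj; apply: nhigh; exists k => j0 kj0.
    by rewrite leNgt; apply/negP => /ltW aj0; apply: nj; exists j0.
  have [c3 [c23 c3j]] := extends_force V (p i j') cPhi qc' qa'.
  exists c3; split; first exact: extends_trans c23.
  move=> q'' a'' q''c q''a; split.
    by exists j; rewrite // (forces_extends c23 c2j q''c q''a).
  by exists j'; rewrite // (c3j _ _ q''c q''a).
have [a [/qP aP [y [/(_ i) ay _]]]] := Phif _ _ qx.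
have : r' <= y i by apply: cvg_seq_ge ay _ => k; have [] := aP k.
have : y i <= r by apply: cvg_seq_le ay _ => k; have [] := aP k.
by lra.
Qed.

(** This is one half of continuity; applied to [- f] it gives the other. *)
Lemma limlim_realizer_usc (R : realType) (p : nat -> nat -> nat) Phi
    (f : R -> R) : pairing p -> seq_continuous Phi ->
  (forall x q, limlim_name p q x -> exists a, Phi q a /\ limlim_name p a (f x)) ->
  forall x r', f x < r' -> \forall z \near x, f z <= r'.
Proof.
move=> pI cPhi Phif x r' fxr'; apply: contrapT => nusc.
have [row rowK] := pairing_row pI.
pose r := (f x + r') / 2.
have [fxr rr'] : f x < r /\ r < r' by rewrite /r; split; lra.
pose c0 := Condition (fun=> 0) 0 (fun=> 0) 0.
pose P k a := exists2 i, (k <= i)%N & row_eventually_ge p i r a.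
have [||q [qx qP]] := @generic_name R p row Phi setT x c0 P pI rowK.
- exact: filterT.
- move=> k c V _ Vx _; apply: contrapT => no.
  have [z Vz fz] : exists2 z, nbhs z V & r' < f z.
    apply: contrapT => nz; apply: nusc; near=> z; rewrite leNgt; apply/negP => fz.
    by apply: nz; exists z => //; near: z; exact: nbhs_interior.
  (* The target moves to [z], with new commitments still in [V], a neighbourhood of both points. If
     all rows from [k] on could be forced low, the resulting name of [z] would give [f z <= r']. *)
  have [|q [qz qP]] := @generic_name R p row Phi V z c
      (fun l => row_eventually_le p (k + l) r') pI rowK Vz.
    move=> l c1 V' V'V V'z cc1.
    have [c2 [c12 [c2low|c2high]]] :=
        decide_row c1 (k + l) pI rowK cPhi Phif V'z rr'; first by exists c2.
    case: no; exists c2; split.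
      exact: extends_trans cc1 (extends_subset V'V c12).
    move=> q a qc qa; exists (k + l)%N; first exact: leq_addr.
    exact: c2high qc qa.
  have [a [/qP aP [y [ay yz]]]] := Phif _ _ qz.
  suff : f z <= r' by lra.
  apply: cvg_seq_le yz _ => N; exists (k + N)%N; first exact: leq_addl.
  apply: cvg_seq_le (ay _) _ => M; have [J JP] := aP N.
  by exists (maxn M J); rewrite ?leq_maxl // JP // leq_maxr.
have [a [/qP aP [y [ay yx]]]] := Phif _ _ qx.
suff : r <= f x by lra.
apply: cvg_seq_ge yx _ => N; have [i Ni [J JP]] := aP N; exists i => //.
apply: cvg_seq_ge (ay _) _ => M.
by exists (maxn M J); rewrite ?leq_maxl // JP // leq_maxr.
Unshelve. all: by end_near.
Qed.

Lemma limlim_realizer_continuous (R : realType) (p : nat -> nat -> nat) Phi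
    (f : R -> R) : pairing p -> seq_continuous Phi ->
  (forall x q, limlim_name p q x -> exists a, Phi q a /\ limlim_name p a (f x)) ->
  continuous f.
Proof.
move=> pI cPhi Phif x; apply/cvgrPdist_le => e e0.
(* Negating the output yields a realizer of [- f], hence lower semicontinuity. *)
pose Phi' q a := Phi q (fun n => - a n).
have cPhi' : seq_continuous Phi'.
  move=> q a m /(cPhi _ _ m)[N NP]; exists N => q' a' /NP H /H.
  exact: oppr_inj.
have Phif' y q : limlim_name p q y ->
    exists a, Phi' q a /\ limlim_name p a (- f y).
  move=> /Phif[a [qa [z [az zy]]]]; exists (fun n => - a n); split.
    by rewrite /Phi' (_ : (fun n => _) = a) //; apply/funext => n; rewrite opprK.
  exists (fun i => - z i); split=> [i|]; last exact: cvgN.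
  under eq_fun do rewrite rmorphN /=.
  exact: cvgN.
have up : \forall z \near x, f z <= f x + e.
  by apply: (limlim_realizer_usc pI cPhi Phif); rewrite ltrDl.
have down : \forall z \near x, - f z <= - f x + e.
  by apply: (limlim_realizer_usc pI cPhi' Phif'); rewrite ltrDl.
near=> z; rewrite ler_distlC; apply/andP; split; last by near: z.
by rewrite -lerN2 opprB addrC; near: z.
Unshelve. all: by end_near.
Qed.

(** * Application to machines with and without oracle *)

Theorem theorem1 (R : realType) (p : nat -> nat -> nat)
    (hp : computable_pairing p) (f : R -> R) :
  [/\ computable (@rho' R) (@rho'_lt R p) f -> lower_semicontinuous (EFin \o f),
      computable (@rho'_lt R p) (@rho'_lt R p) f ->
        {homo f : x y / x <= y}
    & computable (@rho'' R p) (@rho'' R p) f -> continuous f] /\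
  forall O : set (seq symbol),
  [/\ computable_rel O (@rho' R) (@rho'_lt R p) f ->
        lower_semicontinuous (EFin \o f),
      computable_rel O (@rho'_lt R p) (@rho'_lt R p) f ->
        {homo f : x y / x <= y}
    & computable_rel O (@rho'' R p) (@rho'' R p) f -> continuous f].
Proof.
have [pI _] := hp.
(* An oracle-free machine is in particular one with the empty oracle, so the relative statement
   suffices. *)
suff main (O : set (seq symbol)) : [/\ computable_rel O (@rho' R) (@rho'_lt R p) f ->
        lower_semicontinuous (EFin \o f),
      computable_rel O (@rho'_lt R p) (@rho'_lt R p) f ->
        {homo f : x y / x <= y}
    & computable_rel O (@rho'' R p) (@rho'' R p) f -> continuous f].
  split=> //; have [a b c] := main set0.
  by split=> -[M [_ Mf]]; [apply: a|apply: b|apply: c]; exists M.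
split=> -[M Mf]; have cPhi := @machine_rel_continuous O M.
- move=> x r; rewrite lte_fin => rfx.
  exists [set z | r < f z]; last by move=> z; rewrite lte_fin.
  exact: (lt_realizer_lsc cPhi (realizes_machine_rel
    (D := fun q x => (fun n => ratr (q n) : R) @ \oo --> x)
    (D' := @lt_name R p) Mf)).
- exact: (lt_realizer_homo pI cPhi (realizes_machine_rel
    (D := @lt_name R p) (D' := @lt_name R p) Mf)).
- exact: (limlim_realizer_continuous pI cPhi (realizes_machine_rel
    (D := @limlim_name R p) (D' := @limlim_name R p) Mf)).
Qed.
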